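(* Let $(X,f)$ be an equicontinuous cascade on a compact metric space $X$, and let $(2^X,f_* )$ be the induced cascade. Then every member of $E(2^X,f_* )$ is inducible; that is, for every $\alpha\in E(2^X,f_* )$ there is a continuous map $g:X\to X$ such that $\alpha(A)=g(A)$ for all $A\in 2^X$.
   Context: A cascade $(X,f)$ is a homeomorphism $f$ of a compact metric space $(X,d)$, with the $\mathbb{Z}$-action generated by $f$. It is equicontinuous if the family $\{f^n:n\in\mathbb{Z}\}$ is equicontinuous on $X$. $2^X$ is the space of all nonempty closed subsets of $X$ with the Vietoris topology (equivalently, the Hausdorff metric topology), and $f_*:2^X\to 2^X$ is $f_*(A)=f(A)$. The enveloping semigroup $E(2^X,f_* )$ is the closure of $\{f_*^n:n\in\mathbb{Z}\}$ in $(2^X)^{2^X}$ with the product topology (pointwise convergence). A map $\alpha: 2^X\to 2^X$ is called inducible if $\alpha=g_*$ for some continuous $g:X\to X$, where $g_*(A)=g(A)$. *)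

(* Defs.v *)
From HB Require Import structures.
From mathcomp Require Import all_boot all_order all_algebra finmap.
From mathcomp Require Import all_classical all_reals topology.

Set Implicit Arguments.
Unset Strict Implicit.
Unset Printing Implicit Defensive.

Local Open Scope classical_set_scope.

Record homeomorphism (X : topologicalType) := Homeomorphism {
  homeo_fun :> X -> X ;
  homeo_inv : X -> X ;
  homeo_funK : cancel homeo_fun homeo_inv ;
  homeo_invK : cancel homeo_inv homeo_fun ;
  homeo_fun_continuous : continuous homeo_fun ;
  homeo_inv_continuous : continuous homeo_inv }.

Definition homeo_sym (X : topologicalType) (f : homeomorphism X) :
    homeomorphism X :=
  Homeomorphism (homeo_invK f) (homeo_funK f)
    (homeo_inv_continuous (h := f)) (homeo_fun_continuous (h := f)).

(* Negz k is the integer - k.+1. *)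
Definition homeo_iter (X : topologicalType) (f : homeomorphism X) (n : int) :
    X -> X :=
  match n with
  | Posz k => iter k f
  | Negz k => iter k.+1 (homeo_inv f)
  end.

(* The library's equicontinuous requires a pointed codomain; this is its
   epsilon-delta form for the family of all integer iterates. *)
Definition equicontinuous_cascade (R : realType) (X : metricType R)
    (f : homeomorphism X) :=
  forall (x : X) (e : R), (0 < e)%R ->
    exists2 d : R, (0 < d)%R &
      forall y : X, (mdist x y < d)%R ->
        forall n : int, (mdist (homeo_iter f n x) (homeo_iter f n y) < e)%R.

(* {ptws X -> X} is X -> X with the product topology. *)
Definition enveloping_semigroup (X : topologicalType) (f : homeomorphism X) :
    set {ptws X -> X} :=
  closure [set (homeo_iter f n : {ptws X -> X}) | n in [set: int]].

Record hyperspace (X : topologicalType) := Hyperspace {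
  hyperspace_set :> set X ;
  hyperspace_closed : closed hyperspace_set ;
  hyperspace_neq0 : hyperspace_set !=set0 }.

HB.instance Definition _ (X : topologicalType) := gen_eqMixin (hyperspace X).
HB.instance Definition _ (X : topologicalType) :=
  gen_choiceMixin (hyperspace X).

Definition vietoris_sub (X : topologicalType) (U : set X) :
    set (hyperspace X) :=
  [set A : hyperspace X | A `<=` U].

Definition vietoris_meet (X : topologicalType) (U : set X) :
    set (hyperspace X) :=
  [set A : hyperspace X | A `&` U !=set0].

Definition vietoris_subbase (X : topologicalType) :
    set (set (hyperspace X)) :=
  [set vietoris_sub U | U in [set U : set X | open U]] `|`
  [set vietoris_meet U | U in [set U : set X | open U]].

HB.instance Definition _ (X : topologicalType) :=
  isSubBaseTopological.Build (hyperspace X) (@vietoris_subbase X) id.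

Lemma hyperspace_eq (X : topologicalType) (A B : hyperspace X) :
  A = B :> set X -> A = B.
Proof.
case: A => A cA A0; case: B => B cB B0 /= AB; subst B.
by rewrite (Prop_irrelevance cA cB) (Prop_irrelevance A0 B0).
Qed.

Lemma homeo_image (X : topologicalType) (f : homeomorphism X) (A : set X) :
  f @` A = homeo_inv f @^-1` A.
Proof.
apply/seteqP; split => [_ [x Ax <-]|y Ay] /=; first by rewrite homeo_funK.
by exists (homeo_inv f y) => //; rewrite homeo_invK.
Qed.

Lemma homeo_image_closed (X : topologicalType) (f : homeomorphism X)
  (A : set X) : closed A -> closed (f @` A).
Proof.
rewrite homeo_image; apply: preimage_closed => x _.
exact: homeo_inv_continuous.
Qed.

Lemma vietoris_subbase_open (X : topologicalType) (W : set (hyperspace X)) :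
  vietoris_subbase W -> open W.
Proof.
move=> sW; exists [set W]; last by rewrite bigcup_set1.
move=> _ ->; exists [fset W]%fset.
  by move=> V /fset1P ->; rewrite inE.
by rewrite set_fset1 bigcap_set1.
Qed.

Lemma vietoris_continuous (T X : topologicalType) (h : T -> hyperspace X) :
  (forall W, vietoris_subbase W -> open (h @^-1` W)) -> continuous h.
Proof.
move=> hW x A /= [_ [[B sB <-] [C BC Cx] sUBA]].
have : nbhs x (h @^-1` C).
  have /sB [D sD IDC] := BC; rewrite -IDC.
  apply: filter_bigI => E DE; apply: open_nbhs_nbhs; split.
    by apply: hW; apply/set_mem/sD.
  by move: Cx; rewrite -IDC => /(_ _ DE).
by apply: filterS => y Cy; apply: sUBA; exists C.
Qed.

Definition hyperspace_fun (X : topologicalType) (f : homeomorphism X)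
    (A : hyperspace X) : hyperspace X :=
  Hyperspace (homeo_image_closed (f := f) (@hyperspace_closed X A))
             (image_nonempty f (hyperspace_neq0 A)).

Lemma hyperspace_funK (X : topologicalType) (f : homeomorphism X) :
  cancel (hyperspace_fun f) (hyperspace_fun (homeo_sym f)).
Proof.
move=> A; apply: hyperspace_eq; rewrite /= image_comp.
rewrite -[RHS]image_id; apply: eq_imagel => x _ /=.
exact: homeo_funK.
Qed.

Lemma hyperspace_invK (X : topologicalType) (f : homeomorphism X) :
  cancel (hyperspace_fun (homeo_sym f)) (hyperspace_fun f).
Proof.
move=> A; apply: hyperspace_eq; rewrite /= image_comp.
rewrite -[RHS]image_id; apply: eq_imagel => x _ /=.
exact: homeo_invK.
Qed.

Lemma hyperspace_fun_continuous (X : topologicalType) (f : homeomorphism X) :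
  continuous (hyperspace_fun f).
Proof.
have opf (U : set X) : open U -> open (f @^-1` U).
  by move=> oU; apply: open_comp oU => x _; exact: homeo_fun_continuous.
apply: vietoris_continuous => _ [] [U /= oU <-]; apply: vietoris_subbase_open.
  left; exists (f @^-1` U) => /=; first exact: opf.
  by apply/seteqP; split=> A /=; rewrite /vietoris_sub /= image_subP.
right; exists (f @^-1` U) => /=; first exact: opf.
apply/seteqP; split=> A /=.
  by move=> [x [Ax Ufx]]; exists (f x); split=> //; exists x.
by move=> [_ [[x Ax <-] Ufx]]; exists x.
Qed.

(* The induced homeomorphism f_* : A |-> f @` A. *)
Definition hyperspace_homeo (X : topologicalType) (f : homeomorphism X) :
    homeomorphism (hyperspace X) :=
  Homeomorphism (@hyperspace_funK X f) (@hyperspace_invK X f)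
    (@hyperspace_fun_continuous X f)
    (@hyperspace_fun_continuous X (homeo_sym f)).

Definition inducible (X : topologicalType) (a : hyperspace X -> hyperspace X) :=
  exists2 g : X -> X, continuous g &
    forall A : hyperspace X, a A = g @` A :> set X.

(* Main.v *)
Require Import Defs.
From mathcomp Require Import all_boot all_order all_algebra.
From mathcomp Require Import all_classical all_reals topology.
From mathcomp Require Import lra.

(** A point [a] of the enveloping semigroup is a pointwise limit of iterates
    of the induced map along some filter on the integers
    ([enveloping_semigroup_cvg]).  At a singleton [{x}] the iterates are
    singletons [{f^n x}], and a Vietoris limit of singletons in a Hausdorff
    space is again a singleton ([hyperspace1_cvg]); call it [{g x}].  Thus
    [f^n x] tends to [g x] along the same filter for every [x].

    Equicontinuity enters in two ways.  A pointwise limit of an equicontinuous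
    family is continuous ([equicontinuous_limit_continuous]), so [g] is.  And
    near each [x] the iterates stay uniformly close to their values at [x], so
    that, by compactness of [A], the images [f^n(A)] eventually lie in any
    neighbourhood of fixed radius of [g(A)].  The Vietoris limit [a(A)] of
    [f^n(A)] is therefore contained in the compact set [g(A)].  The reverse
    inclusion follows from the pointwise convergence, [a(A)] being closed; both
    are in [image_hyperspace_limit]. *)

Set Implicit Arguments.
Unset Strict Implicit.
Unset Printing Implicit Defensive.

Import Order.TTheory GRing.Theory Num.Theory.
Import metricType_numDomainType.

Local Open Scope ring_scope.
Local Open Scope classical_set_scope.

(** The filter is the trace on the index set of the neighbourhoods of [a]; it
    is proper because [a] is adherent to the iterates.  A sequence of iterates
    need not suffice, since the product topology is not first countable in
    general. *)
Lemma enveloping_semigroup_cvg (Y : topologicalType) (f : homeomorphism Y)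
    (a : {ptws Y -> Y}) :
  enveloping_semigroup f a ->
  exists2 F : set_system int, ProperFilter F &
    forall y, homeo_iter f n y @[n --> F] --> a y.
Proof.
move=> fa.
exists [set P : set int | nbhs a
  [set h : {ptws Y -> Y} | forall n, h = homeo_iter f n -> P n]]; last first.
  move=> y W Wy /=.
  have : nbhs a [set h : {ptws Y -> Y} | W (h y)].
    exact: (@proj_continuous Y (fun=> Y) y a W Wy).
  by apply: filterS => h + n hn; rewrite /= hn.
split.
  by move=> /fa[h [[n _ <-]]] /(_ n erefl).
split.
- by apply: filterS (@filterT _ (nbhs a) _) => h _ n _.
- move=> P Q /=; apply: filterS2 => h hP hQ n hn.
  by split; [exact: hP|exact: hQ].
- move=> P Q PQ /=; apply: filterS => h hP n hn.
  exact/PQ/hP.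
Qed.

Lemma homeo_iter_hyperspace (X : topologicalType) (f : homeomorphism X) n
    (A : hyperspace X) :
  homeo_iter (hyperspace_homeo f) n A = homeo_iter f n @` A :> set X.
Proof.
have iterE (h : homeomorphism X) k :
    iter k (hyperspace_fun h) A = iter k h @` A :> set X.
  by elim: k => [|k IH]; rewrite ?image_id//= IH image_comp.
by case: n => n; [exact: iterE|exact: (iterE (homeo_sym f) n.+1)].
Qed.

Section vietoris_limits.
Context {X : topologicalType} {I : Type} (F : set_system I) {FF : Filter F}.
Implicit Types (u : I -> hyperspace X) (B : hyperspace X).

Lemma vietoris_cvg_sub u B (U : set X) : u @ F --> B -> open U ->
  B `<=` U -> \forall i \near F, u i `<=` U.
Proof.
move=> uB oU BU; apply: (uB (vietoris_sub U)); apply: open_nbhs_nbhs; split=> //.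
by apply: vietoris_subbase_open; left; exists U.
Qed.

Lemma vietoris_cvg_meet u B (U : set X) p : u @ F --> B ->
  hyperspace_set B p -> nbhs p U -> \forall i \near F, u i `&` U !=set0.
Proof.
move=> uB Bp pU.
have : \forall i \near F, u i `&` U° !=set0.
  apply: (uB (vietoris_meet U°)); apply: open_nbhs_nbhs; split.
    by apply: vietoris_subbase_open; right; exists U° => //; exact: open_interior.
  by exists p.
by apply: filterS => i [x [ux Ux]]; exists x; split=> //; exact: interior_subset.
Qed.

End vietoris_limits.

Definition hyperspace1 (X : topologicalType) (hX : hausdorff_space X) (x : X) :
    hyperspace X :=
  Hyperspace (accessible_closed_set1 (hausdorff_accessible hX) (x := x))
    (ex_intro _ x erefl : [set x] !=set0).

(** The neighbourhoods of any point of [B] are eventually met by the one-point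
    sets, so every point of [B] is a limit of [v], and such a limit is unique. *)
Lemma hyperspace1_cvg (X : topologicalType) (hX : hausdorff_space X) (I : Type)
    (F : set_system I) (FF : ProperFilter F) (v : I -> X) (B : hyperspace X) :
  hyperspace1 hX (v i) @[i --> F] --> B ->
  exists2 p, B = [set p] :> set X & v @ F --> p.
Proof.
move=> vB.
have cvgB q : hyperspace_set B q -> v @ F --> q.
  move=> Bq W qW; apply: filterS (vietoris_cvg_meet vB Bq qW).
  by move=> i [_ [-> ]].
have [p Bp] := hyperspace_neq0 B.
exists p; last exact: cvgB.
apply/seteqP; split=> [q Bq|_ ->//].
by apply: (cvg_unique hX _ (cvgB _ Bp)); exact: cvgB.
Qed.

Section equicontinuous_limit.
Context {R : realType} {X : metricType R} {I : Type}.
Context (F : set_system I) {FF : ProperFilter F} (v : I -> X -> X) (g : X -> X).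
Hypothesis v_equi : forall (x : X) (e : R), 0 < e ->
  \forall y \near x, forall i, mdist (v i x) (v i y) < e.
Hypothesis v_cvg : forall x, v i x @[i --> F] --> g x.

Lemma equicontinuous_limit_continuous : continuous g.
Proof.
move=> x; apply/cvgrPdist_lt => e e0.
have e3 : 0 < e / 3 by rewrite divr_gt0.
apply: filterS (v_equi x e3) => y xy.
have [i [xi yi]] := filter_ex (filterI (cvgr_dist_lt (v_cvg (x:=x)) e3)
                                       (cvgr_dist_lt (v_cvg (x:=y)) e3)).
have := metric_triangle (g x) (v i x) (g y).
have := metric_triangle (v i x) (v i y) (g y).
rewrite (metric_sym (v i y)) => h1 h2; have := xy i; lra.
Qed.

(** A point [y] outside the closed set [g(A)] has distance at least some [e]
    from it.  Each [x] in [A] has a neighbourhood whose points are eventually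
    sent at distance at least [e / 3] from [y]; compactness makes the index
    uniform over [A], so the images of [A] eventually avoid a ball around [y],
    and [y] is not in their limit. *)
Lemma image_hyperspace_limit (A B : hyperspace X) (u : I -> hyperspace X) :
  compact A -> (forall i, u i = v i @` A :> set X) -> u @ F --> B ->
  B = g @` A :> set X.
Proof.
move=> cA uE uB; apply/seteqP; split=> [y By|_ [x Ax <-]]; last first.
  apply: contrapT => Bgx.
  have /nbhs_mdistP[e /= e0 eB] : nbhs (g x) (~` B).
    by apply: open_nbhs_nbhs; split=> //; exact/closed_openC/hyperspace_closed.
  have e2 : 0 < e / 2 by rewrite divr_gt0.
  (* the interior separates [B] from the smaller ball by an open set *)
  have BU : B `<=` [set z | e / 2 <= mdist (g x) z]°.
    move=> b Bb; apply/nbhs_mdistP; exists (e / 2) => //= z bz.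
    rewrite /= leNgt; apply/negP => xz; apply: (eB b) => //=.
    have := metric_triangle (g x) z b; rewrite (metric_sym z).
    by move: bz xz => /=; lra.
  have [i [iU ix]] := filter_ex (filterI
    (vietoris_cvg_sub uB (@open_interior _ _) BU)
    (cvgr_dist_lt (v_cvg (x:=x)) e2)).
  have /iU/interior_subset/= : hyperspace_set (u i) (v i x) by rewrite uE; exists x.
  by rewrite leNgt ix.
apply: contrapT => gAy.
have cg : compact (g @` A).
  apply: continuous_compact => //; apply: continuous_subspaceT.
  exact: equicontinuous_limit_continuous.
have /nbhs_mdistP[e /= e0 eA] : nbhs y (~` (g @` A)).
  apply: open_nbhs_nbhs; split=> //; apply: closed_openC.
  by apply: compact_closed => //; exact: metric_hausdorff.
have e3 : 0 < e / 3 by rewrite divr_gt0.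
have far : \forall i \near F, A `<=` [set x | e / 3 <= mdist y (v i x)].
  move/compact_near_coveringP: cA; apply=> x Ax.
  exists ([set x' | forall i, mdist (v i x) (v i x') < e / 3],
          [set i | mdist (g x) (v i x) < e / 3]) => /=.
    by split; [exact: v_equi|exact: cvgr_dist_lt].
  move=> [x' i] /= [/(_ i) xx' gx].
  have : e <= mdist y (g x).
    by rewrite leNgt; apply/negP => /eA; apply; exists x.
  have := metric_triangle y (v i x') (g x).
  have := metric_triangle (v i x') (v i x) (g x).
  rewrite (metric_sym (v i x') (v i x)) (metric_sym (v i x) (g x)) /=; lra.
have yball : nbhs y [set z | mdist y z < e / 3].
  by apply/nbhs_mdistP; exists (e / 3).
have [i [iA [z [uz yz]]]] :=
  filter_ex (filterI far (vietoris_cvg_meet uB By yball)).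
move: uz; rewrite uE => -[x Ax xz].
by have := iA _ Ax; rewrite /= xz leNgt yz.
Qed.

End equicontinuous_limit.

Theorem theorem10p1 (R : realType) (X : metricType R) (f : homeomorphism X)
  (Xcompact : compact [set: X])
  (fequi : equicontinuous_cascade f)
  (a : {ptws hyperspace X -> hyperspace X}) :
  enveloping_semigroup (hyperspace_homeo f) a -> inducible a.
Proof.
move=> /enveloping_semigroup_cvg[F FF Fa].
have hX : hausdorff_space X by exact: metric_hausdorff.
have lim_pt x : exists p : X, homeo_iter f n x @[n --> F] --> p.
  have [p _ xp] : exists2 p, a (hyperspace1 hX x) = [set p] :> set X &
      homeo_iter f n x @[n --> F] --> p.
    apply: (hyperspace1_cvg (hX := hX)).
    rewrite [X in X @ F](_ : _ =
        fun n => homeo_iter (hyperspace_homeo f) n (hyperspace1 hX x)) //.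
    apply/funext => n; apply: hyperspace_eq.
    by rewrite homeo_iter_hyperspace /= image_set1.
  by exists p.
have [g fg] := choice lim_pt.
have f_equi (x : X) (e : R) : 0 < e ->
    \forall y \near x, forall n, mdist (homeo_iter f n x) (homeo_iter f n y) < e.
  by move=> /(fequi x)[d d0 xd]; apply/nbhs_mdistP; exists d.
exists g; first exact: equicontinuous_limit_continuous f_equi fg.
move=> A; apply: (image_hyperspace_limit f_equi fg _ _ (Fa A)).
  by apply: (subclosed_compact _ Xcompact) => //; exact: hyperspace_closed.
by move=> n; exact: homeo_iter_hyperspace.
Qed.
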